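(* For any $m\in \mathbb{N}^*$, for any $q,n \in \mathbb{N}$ such that $n \geq q$ and for any sequence $(a_N)$ of complex numbers defined for integers $N\in[q,n]$, we have $$\sum_{N_m=q}^{n}\cdots \sum_{N_2=q}^{N_3}\sum_{N_1=q}^{N_2}a_{N_1}=\sum_{i=q}^{n}\binom{n+(m-1)-i}{m-1}a_{i}.$$
   Context: $\mathbb{N}=\{0,1,2,\dots\}$ and $\mathbb{N}^*=\{1,2,\dots\}$. The left-hand side is an $m$-fold nested sum: with $N_{m+1}:=n$, the index $N_j$ runs from $q$ to $N_{j+1}$ for $j=m,m-1,\dots,1$; for $m=1$ it is $\sum_{N_1=q}^{n}a_{N_1}$. *)

(* Defs.v *)
From HB Require Import structures.
From mathcomp Require Import all_boot all_order all_algebra.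
From mathcomp Require Import reals complex.

Set Implicit Arguments.
Unset Strict Implicit.
Unset Printing Implicit Defensive.

Import GRing.Theory.
Local Open Scope ring_scope.

(* [nested_sum a q m n] is
     \sum_(N_m = q)^n ... \sum_(N_2 = q)^(N_3) \sum_(N_1 = q)^(N_2) a_(N_1),
   the recursion peeling off the outermost index N_m; all upper bounds are
   inclusive, hence the [.+1].  With no summation left, the innermost index
   has been passed down as [n], so the summand is [a n]. *)
Fixpoint nested_sum (V : nmodType) (a : nat -> V) (q m n : nat) : V :=
  if m is k.+1 then \sum_(q <= N < n.+1) nested_sum a q k N else a n.

(* Main.v *)
Require Import Defs.
From HB Require Import structures.
From mathcomp Require Import all_boot all_order all_algebra.
From mathcomp Require Import reals complex.

Set Implicit Arguments.
Unset Strict Implicit.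
Unset Printing Implicit Defensive.

Import GRing.Theory.
Local Open Scope ring_scope.

(** A summand [a i] occurs in the nested sum once for each weakly increasing
    chain i <= N_2 <= ... <= N_m <= n, so the theorem is a count of chains.
    Induction on the number of sums does the counting: exchanging the
    outermost sum with the closed form of the inner ones
    ([exchange_big_triangle]) collects, for each i, the coefficients
    'C(N - i + k, k) for N from i to n, and the hockey-stick identity
    ([sum_bin_diag]) adds them up to 'C(n - i + k.+1, k.+1).  Only additions
    of the a_i are involved, so the induction is done in an arbitrary
    commutative monoid, the coefficients acting as multiples [*+]. *)

(** The hockey-stick identity: by Pascal's rule each new term is the increment
    of the right-hand side. *)
Lemma sum_bin_diag (k d : nat) :
  (\sum_(0 <= j < d.+1) 'C(j + k, k) = 'C(d + k.+1, k.+1))%N.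
Proof.
elim: d => [|d IHd]; first by rewrite big_nat1 !add0n !binn.
by rewrite big_nat_recr //= IHd [in RHS]addSn binS -addSnnS.
Qed.

(** Both sides run over the triangle q <= i <= N <= n, by rows and by
    columns. *)
Lemma exchange_big_triangle (V : nmodType) (F : nat -> nat -> V) (q n : nat) :
  \sum_(q <= N < n.+1) \sum_(q <= i < N.+1) F N i =
  \sum_(q <= i < n.+1) \sum_(i <= N < n.+1) F N i.
Proof.
transitivity (\sum_(q <= N < n.+1) \sum_(q <= i < n.+1 | (i <= N)%N) F N i).
  apply: eq_big_nat => N /andP[_ ltNn].
  by rewrite (big_nat_widen q N.+1 n.+1).
rewrite (exchange_big_dep_nat predT) //=.
apply: eq_big_nat => i /andP[leqi _].
by rewrite (big_nat_widenl i q) //=; apply: eq_bigl => N; rewrite andbT.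
Qed.

Lemma nested_sumS (V : nmodType) (a : nat -> V) (q k n : nat) :
  nested_sum a q k.+1 n = \sum_(q <= i < n.+1) a i *+ 'C(n - i + k, k).
Proof.
elim: k n => [|k IHk] n; first by apply: eq_bigr => i _; rewrite bin0.
transitivity (\sum_(q <= N < n.+1)
    \sum_(q <= i < N.+1) a i *+ 'C(N - i + k, k)).
  by apply: eq_bigr => N _; apply: IHk.
rewrite exchange_big_triangle; apply: eq_big_nat => i /andP[_ lein].
rewrite sumrMnr -sum_bin_diag -subSn //; congr (_ *+ _).
(* Shifting N by i turns the column sum into a sum from 0 to n - i. *)
rewrite -[X in index_iota X n.+1](add0n i) big_addn.
by apply: eq_bigr => j _; rewrite addnK.
Qed.

Theorem theorem5p3 (R : realType) (m q n : nat) (a : nat -> R[i])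
    (hm : (1 <= m)%N) (hqn : (q <= n)%N) :
  nested_sum a q m n =
  \sum_(q <= i < n.+1) 'C(n + (m - 1) - i, m - 1)%:R * a i.
Proof.
case: m hm => // k _; rewrite subn1 nested_sumS.
apply: eq_big_nat => i /andP[_ lein].
by rewrite mulr_natl addnBAC.
Qed.
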